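(* Let $p$ be a prime, and let $\alpha = (2,\ldots,2,1,\ldots,1)$ be a composition of length $n-1$ with $r$ entries equal to $2$ (coming first) followed by $s$ entries equal to $1$, so that $r+s=n-1$. Then $g_\alpha(p) \ge p^{rs}$.
   Context: Addition and multiplication on $\mathbb{Z}^n$ are componentwise, and a subring of $\mathbb{Z}^n$ means a multiplicatively closed finite index sublattice containing $(1,\ldots,1)$. A subring $L\subseteq\mathbb{Z}^n$ whose index is a power of the prime $p$ is irreducible if $x_1\equiv x_2\equiv\cdots\equiv x_n \pmod p$ for every $(x_1,\ldots,x_n)\in L$. A matrix $A=(a_{ij})\in M_n(\mathbb{Z})$ with positive determinant is in Hermite normal form if it is upper triangular and $0\le a_{ij}<a_{ii}$ for $1\le i<j\le n$. Every finite index sublattice of $\mathbb{Z}^n$ is the column span (set of integer linear combinations of the columns) of a unique such matrix, and the index equals $\det(A)$; the diagonal entries of the sublattice are the diagonal entries $(a_{11},\ldots,a_{nn})$ of this matrix. A composition of a positive integer is a list of positive integers (its parts) with that sum; the number of parts is its length. For a composition $\alpha=(\alpha_1,\ldots,\alpha_{n-1})$ of length $n-1$, $g_\alpha(p)$ denotes the number of irreducible subrings of $\mathbb{Z}^n$ (of $p$-power index) with diagonal entries $(p^{\alpha_1},p^{\alpha_2},\ldots,p^{\alpha_{n-1}},1)$. *)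

(* Defs.v *)
From HB Require Import structures.
From mathcomp Require Export all_boot all_order all_algebra.
From mathcomp Require Export finmap.
From mathcomp Require Export boolp classical_sets functions cardinality.

Set Implicit Arguments.
Unset Strict Implicit.
Unset Printing Implicit Defensive.

Local Open Scope classical_set_scope.
Local Open Scope ring_scope.

(* Elements of Z^n are column vectors.  The type 'cV[int]_n carries no ring
   product, so the componentwise product is written map2_mx *%R x y; the
   vector (1, ..., 1) is const_mx 1. *)

Definition cosets n (L : set 'cV[int]_n) : set (set 'cV[int]_n) :=
  range (fun x : 'cV[int]_n => [set x + y | y in L]).

Definition finite_index_sublattice n (L : set 'cV[int]_n) : Prop :=
  zmod_closed [in L] /\ finite_set (cosets L).

(* fset_set sends infinite sets to the empty one, so this is the index of L
   when it is finite and 0 otherwise. *)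
Definition lattice_index n (L : set 'cV[int]_n) : nat := #|` fset_set (cosets L)|%fset.

Definition is_subring n (L : set 'cV[int]_n) : Prop :=
  [/\ finite_index_sublattice L,
      L (const_mx 1) &
      forall x y, L x -> L y -> L (map2_mx *%R x y)].

Definition irreducible_subring n (p : nat) (L : set 'cV[int]_n) : Prop :=
  [/\ is_subring L,
      exists k : nat, lattice_index L = (p ^ k)%N &
      forall x, L x -> forall i j, (x i ord0 = x j ord0 %[mod p%:Z])%Z].

Definition hermite_normal_form n (A : 'M[int]_n) : Prop :=
  [/\ 0 < \det A,
      forall i j : 'I_n, (j < i)%N -> A i j = 0 &
      forall i j : 'I_n, (i < j)%N -> 0 <= A i j < A i i].

Definition column_span n (A : 'M[int]_n) : set 'cV[int]_n :=
  range (fun v : 'cV[int]_n => A *m v).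

(* The existential picks out the Hermite normal form of L, which is unique. *)
Definition has_diagonal n (L : set 'cV[int]_n) (d : seq nat) : Prop :=
  exists A : 'M[int]_n,
    [/\ hermite_normal_form A, L = column_span A &
        [seq A i i | i <- enum 'I_n] = [seq a%:Z | a <- d]].

Definition is_composition (m : nat) (alpha : seq nat) : Prop :=
  [/\ (0 < m)%N, all (fun a => 0 < a)%N alpha & sumn alpha = m].

(* g_alpha(p), for alpha of length n - 1.  The set being counted is finite:
   its members are determined by the Hermite normal forms with the given
   diagonal. *)
Definition g (n : nat) (alpha : seq nat) (p : nat) : nat :=
  #|` fset_set [set L : set 'cV[int]_n | irreducible_subring p L /\
        has_diagonal L (rcons [seq (p ^ a)%N | a <- alpha] 1%N)]|%fset.

(* Main.v *)
(* For every r x s matrix B with entries in [0, p), the matrix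
     [ p^2 I  p B  1 ]
     [   0    p I  1 ]
     [   0     0   1 ]
   is in Hermite normal form with the required diagonal.  Its column span L
   consists of the vectors t (1, ..., 1) + p (p z + B y, y, 0).  The product of
   two vectors of the form p (q, y, 0) is p^2 (q q', y y', 0), which is in L
   since p^2 (u, 0, 0) is in L for every u, and p^2 (B (y y'), y y', 0) is p
   times an element of L; so L is a subring whatever B is.  The vectors
   (a, b, 0) with a in [0, p^2)^r and b in [0, p)^s represent each coset of L
   once, so the index is p^(2r+s).  The p^(rs) choices of B give distinct L by
   uniqueness of remainders modulo p. *)

Require Import Defs.
From mathcomp Require Import ring zify.

Import Order.TTheory GRing.Theory Num.Theory.

Set Implicit Arguments.
Unset Strict Implicit.
Unset Printing Implicit Defensive.

Local Open Scope classical_set_scope.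
Local Open Scope ring_scope.

(** * Counting images, and remainders modulo [k] *)

Lemma card_fset_set_range (F : finType) (T : choiceType) (h : F -> T) :
  injective h -> #|` fset_set (range h)|%fset = #|F|.
Proof.
move=> h_inj; rewrite (fset_set_image _ finite_finset) card_imfset //=.
rewrite [in RHS]cardE; apply: perm_size; apply: uniq_perm => [||x].
- exact: fset_uniq.
- exact: enum_uniq.
by rewrite mem_enum inE in_fset_set ?in_setT //; exact: finite_finset.
Qed.

Lemma ord_eq_mod k (a b : 'I_k) (z : int) : a%:Z = k%:Z * z + b%:Z -> a = b.
Proof.
move=> /(congr1 (modz^~ k%:Z)); rewrite mulrC modzMDl !modz_nat => -[].
by rewrite !modn_small // => ?; exact: val_inj.
Qed.

(** Reduced matrices, with entries in [0, k), are encoded over ['I_k] so that they form a finite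
    type of known cardinality. *)
Definition ord_mx k a b (X : 'M['I_k]_(a, b)) : 'M[int]_(a, b) :=
  map_mx (fun i : 'I_k => i%:Z) X.

Lemma ord_mx_mod_inj k a b (X Y : 'M['I_k]_(a, b)) Z :
  ord_mx X = k%:Z *: Z + ord_mx Y -> X = Y.
Proof.
move=> /matrixP XY; apply/matrixP => i j.
by move: (XY i j); rewrite !mxE; exact: ord_eq_mod.
Qed.

Lemma ord_mx_divmod k a b (X : 'M[int]_(a, b)) : (0 < k)%N ->
  exists Y : 'M['I_k]_(a, b), exists Z, X = k%:Z *: Z + ord_mx Y.
Proof.
move=> k_gt0; have lt_mod x : (`|(x %% k%:Z)%Z|%N < k)%N by lia.
exists (map_mx (fun x => Ordinal (lt_mod x)) X).
exists (map_mx (divz^~ k%:Z) X); apply/matrixP => i j; rewrite !mxE /=.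
by rewrite gez0_abs ?modz_ge0 ?[_ * (_ %/ _)%Z]mulrC -?divz_eq //; lia.
Qed.

(** * Cosets of a sublattice, and lattices with a given diagonal *)

Section CosetSet.
Variables (n : nat) (L : set 'cV[int]_n).
Hypothesis L_zmod : zmod_closed [in L].

Lemma coset_eq (x y : 'cV[int]_n) :
  ([set x + z | z in L] = [set y + z | z in L]) <-> L (x - y).
Proof.
have [L0 LB] : L 0 /\ forall u v, L u -> L v -> L (u - v).
  have [L0 LB] := L_zmod; split; first by rewrite inE in L0.
  by move=> u v Lu Lv; move: (LB u v); rewrite !inE => /(_ Lu Lv).
have LN u : L u -> L (- u) by rewrite -sub0r; exact: LB.
split=> [xy | Lxy].
  have : [set y + z | z in L] x by rewrite -xy; exists 0; rewrite ?addr0.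
  by case=> z Lz <-; rewrite [y + z]addrC addrK.
apply/seteqP; split=> _ [z Lz <-].
  exists (x - y + z); last by rewrite addrA [x - y]addrC addrA subrr add0r.
  by rewrite -[z]opprK; apply/LB/LN.
exists (z - (x - y)); first exact: LB.
by rewrite opprB addrCA [x + _]addrC -addrA addNr addr0 addrC.
Qed.

End CosetSet.

(** [fset_set] sends an infinite set to the empty one, so a lower bound on [g] requires this
    finiteness. *)
Lemma finite_has_diagonal n (d : seq nat) :
  finite_set [set L : set 'cV[int]_n | has_diagonal L d].
Proof.
(* [M] exceeds every diagonal entry, hence every entry of a Hermite normal form with diagonal [d];
   so the quotient [Z] of the division by [M] below vanishes. *)
pose M := (\max_(a <- d) a).+1.
pose f (X : 'M['I_M]_n) := column_span (ord_mx X).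
apply: (@sub_finite_set _ _ (range f)); last exact/finite_image/finite_finset.
move=> _ [A [[_ A_low A_up] -> Ad]].
have A_diag i : exists2 a : nat, A i i = a & (a < M)%N.
  have : A i i \in [seq a%:Z | a <- d] by rewrite -Ad; apply/mapP; exists i; rewrite ?mem_enum.
  by case/mapP=> a ad ->; exists a => //; rewrite ltnS (@leq_bigmax_seq _ _ _ id).
have A_bnd i j : 0 <= A i j < M%:Z.
  have [a Aii aM] := A_diag i; have [ij | ji | /val_inj <-] := ltngtP i j.
  - by have := A_up i j ij; rewrite Aii; lia.
  - by rewrite A_low.
  - by rewrite Aii; lia.
have [X [Z AXZ]] := ord_mx_divmod A (ltn0Sn (\max_(a <- d) a)).
exists X => //; rewrite /f; congr column_span; rewrite AXZ.
suff -> : Z = 0 by rewrite scaler0 add0r.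
apply/matrixP => i j; have := A_bnd i j; rewrite {1 2}AXZ !mxE.
by have := ltn_ord (X i j); rewrite -/M; nia.
Qed.

(** * The column span as an irreducible subring *)

Section Lattice.
Variables (p r s : nat) (B : 'M[int]_(r, s)).
Hypothesis p_gt0 : (0 < p)%N.

Definition hermite_mx : 'M[int]_(r + s + 1) :=
  block_mx (block_mx (p%:Z ^+ 2)%:M (p%:Z *: B) 0 (p%:Z)%:M)
    (const_mx 1) 0 1%:M.

Definition span_vec z y (t : int) : 'cV[int]_(r + s + 1) :=
  col_mx (p%:Z *: col_mx (p%:Z *: z + B *m y) y) 0 + const_mx t.

Let L := column_span hermite_mx.

Lemma span_vec0 z y : span_vec z y 0 =
  col_mx (col_mx (p%:Z *: (p%:Z *: z + B *m y)) (p%:Z *: y)) 0.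
Proof.
by rewrite /span_vec scale_col_mx; apply/colP => i; rewrite !mxE addr0.
Qed.

Lemma hermite_mx_spanP x : L x <-> exists z y t, x = span_vec z y t.
Proof.
have E z y t : hermite_mx *m col_mx (col_mx z y) (const_mx t) = span_vec z y t.
  rewrite /hermite_mx /span_vec !mul_block_col !mul0mx !add0r mul1mx.
  rewrite !mul_scalar_mx -[X in _ = _ + X]vsubmxK add_col_mx add0r; congr col_mx.
    rewrite scale_col_mx scalerDr scalerA -expr2 scalemxAl; congr (_ + _).
    by apply/colP => i; rewrite !mxE big_ord1 !mxE mul1r.
  by apply/colP => i; rewrite !mxE.
split=> [[v _ <-] | [z [y [t ->]]]]; last by rewrite -E; eexists.
exists (usubmx (usubmx v)), (dsubmx (usubmx v)), (dsubmx v 0 0).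
rewrite -E !vsubmxK; congr (_ *m _); rewrite -[LHS]vsubmxK; congr col_mx.
by apply/colP => i; rewrite [RHS]mxE [i]ord1.
Qed.

Lemma span_vec_coord u w z y t :
  col_mx (col_mx u w) 0 = span_vec z y t ->
  [/\ u = p%:Z *: (p%:Z *: z + B *m y), w = p%:Z *: y & t = 0].
Proof.
move=> E; have t0 : t = 0.
  by move/colP/(_ (rshift _ ord0)): E; rewrite [RHS]mxE !col_mxEd !mxE add0r.
move: E; rewrite t0 span_vec0.
by move=> /eq_col_mx[/eq_col_mx[-> ->]].
Qed.

Lemma span_vecB z y t z' y' t' :
  span_vec z y t - span_vec z' y' t' = span_vec (z - z') (y - y') (t - t').
Proof.
rewrite /span_vec; apply/colP => i; rewrite !mxE.
case: split_ordP => [{}i|{}i] _; rewrite !mxE; last by ring.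
by case: split_ordP => [{}i|{}i] _; rewrite ?mulmxBr !mxE; ring.
Qed.

(** The middle block p^2 yy forces the parameter p yy, which adds p^2 B yy to the top block; the
    term [- B *m yy] in the first parameter cancels it. *)
Lemma span_vecM z y t z' y' t' :
  let q := p%:Z *: z + B *m y in let q' := p%:Z *: z' + B *m y' in
  let yy := map2_mx *%R y y' in
  map2_mx *%R (span_vec z y t) (span_vec z' y' t') =
  span_vec (map2_mx *%R q q' + t *: z' + t' *: z - B *m yy)
    (p%:Z *: yy + t *: y' + t' *: y) (t * t').
Proof.
move=> q q' yy; rewrite /span_vec !mulmxDr -!scalemxAr.
(* Eliminating [B *m y] and [B *m y'] in favour of [q] and [q'] leaves an identity that [ring] can
   check coordinatewise. *)
have <- : q - p%:Z *: z = B *m y by rewrite /q addrC addKr.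
have <- : q' - p%:Z *: z' = B *m y' by rewrite /q' addrC addKr.
move: (B *m yy) q q' => b q q'; rewrite {}/yy; apply/colP => i; rewrite !mxE.
case: split_ordP => [{}i|{}i] _; rewrite !mxE; last by ring.
by case: split_ordP => [{}i|{}i] _; rewrite !mxE; ring.
Qed.

Lemma hermite_mx_span_zmod : zmod_closed [in L].
Proof.
split=> [|u v]; rewrite !inE.
  by exists 0; rewrite ?mulmx0.
move=> /hermite_mx_spanP[z [y [t ->]]] /hermite_mx_spanP[z' [y' [t' ->]]].
by apply/hermite_mx_spanP; rewrite span_vecB; do 3 eexists.
Qed.

Definition coset_rep (ab : 'cV['I_(p ^ 2)]_r * 'cV['I_p]_s) :
    'cV[int]_(r + s + 1) :=
  col_mx (col_mx (ord_mx ab.1) (ord_mx ab.2)) 0.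

Lemma coset_rep_inj : injective (fun ab => [set coset_rep ab + y | y in L]).
Proof.
move=> [a b] [a' b'] /(coset_eq hermite_mx_span_zmod).
rewrite /coset_rep /= !opp_col_mx !add_col_mx subr0.
case/hermite_mx_spanP=> z [y [t /span_vec_coord[ea eb _]]].
have {}eb : ord_mx b = p%:Z *: y + ord_mx b' by rewrite -eb subrK.
have bb := ord_mx_mod_inj eb; congr pair => //.
(* With [y = 0] the term [B *m y] disappears, and the top block becomes a congruence modulo p^2. *)
suff y0 : y = 0.
  apply: (@ord_mx_mod_inj _ _ _ _ _ z); move: ea.
  by rewrite y0 mulmx0 addr0 scalerA -PoszM mulnn => <-; rewrite subrK.
apply/colP => i; move/colP/(_ i): eb; rewrite bb !mxE; nia.
Qed.

Lemma cosets_hermite_mx_span :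
  cosets L = range (fun ab => [set coset_rep ab + y | y in L]).
Proof.
apply/seteqP; split=> _ [x _ <-]; last by exists (coset_rep x).
(* Clear the last coordinate with a multiple of (1, ..., 1), then reduce the middle block modulo p.
   This shifts the top block by p B y, which is removed before reducing modulo p^2. *)
pose t := dsubmx x 0 0; pose w := usubmx x - const_mx t.
have [b [y yb]] := ord_mx_divmod (dsubmx w) p_gt0.
have p2_gt0 : (0 < p ^ 2)%N by rewrite expn_gt0 p_gt0.
have [a [z za]] := ord_mx_divmod (usubmx w - p%:Z *: (B *m y)) p2_gt0.
exists (a, b) => //; apply/esym/(coset_eq hermite_mx_span_zmod)/hermite_mx_spanP.
exists z, y, t; rewrite /coset_rep /span_vec /=.
have -> : x = col_mx (col_mx (usubmx w) (dsubmx w)) 0 + const_mx t.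
  rewrite vsubmxK -[LHS]vsubmxK -[const_mx t]vsubmxK add_col_mx; congr col_mx.
    by apply/colP => i; rewrite !mxE subrK.
  by rewrite add0r; apply/colP => i; rewrite [i]ord1 [RHS]mxE [RHS]mxE.
rewrite addrAC; congr (_ + _); rewrite opp_col_mx add_col_mx subr0; congr col_mx.
rewrite yb -[usubmx w](subrK (p%:Z *: (B *m y))) za opp_col_mx add_col_mx addrK.
rewrite addrAC addrK scale_col_mx; congr col_mx.
by rewrite scalerDr scalerA -PoszM mulnn.
Qed.

Lemma hermite_mx_span_irreducible : irreducible_subring p L.
Proof.
split; first split.
- split; first exact: hermite_mx_span_zmod.
  by rewrite cosets_hermite_mx_span; exact/finite_image/finite_finset.
- apply/hermite_mx_spanP; exists 0, 0, 1.
  by rewrite /span_vec mulmx0 scaler0 addr0 col_mx0 scaler0 col_mx0 add0r.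
- move=> _ _ /hermite_mx_spanP[z [y [t ->]]] /hermite_mx_spanP[z' [y' [t' ->]]].
  by apply/hermite_mx_spanP; rewrite span_vecM; do 3 eexists.
- exists (2 * r + s)%N.
  rewrite /lattice_index cosets_hermite_mx_span card_fset_set_range.
    by rewrite card_prod !card_mx !card_ord !muln1 expnD expnM.
  exact: coset_rep_inj.
move=> _ /hermite_mx_spanP[z [y [t ->]]].
(* All coordinates are congruent to [t] modulo p, hence to each other. *)
have modt i : exists c, span_vec z y t i ord0 = c * p%:Z + t.
  rewrite /span_vec mxE [col_mx _ _ _ _]mxE [const_mx _ _ _]mxE.
  case: split_ordP => [{}i|{}i] _.
    by rewrite mxE mulrC; eexists.
  by exists 0; rewrite mxE mul0r.
move=> i j; have [c ->] := modt i; have [c' ->] := modt j.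
by rewrite !modzMDl.
Qed.

End Lattice.

(** * Diagonal and Hermite normal form of the matrix *)

Lemma enum_ordD m n :
  enum 'I_(m + n) = map (lshift n) (enum 'I_m) ++ map (@rshift m n) (enum 'I_n).
Proof.
apply: (inj_map val_inj); rewrite val_enum_ord iotaD map_cat.
rewrite -[(0 + m)%N]addnC iotaDl -!val_enum_ord.
by congr (_ ++ _); rewrite -!map_comp.
Qed.

Section HermiteForm.
Variables (p r s : nat) (X : 'M['I_p]_(r, s)).

Lemma hermite_mx_diagonal :
  [seq hermite_mx p (ord_mx X) i i | i <- enum 'I_(r + s + 1)] =
  [seq a%:Z | a <- rcons [seq (p ^ a)%N | a <- nseq r 2%N ++ nseq s 1%N] 1%N].
Proof.
have map_const n (F : 'I_n -> int) a : (forall i, F i = a) ->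
    [seq F i | i <- enum 'I_n] = nseq n a.
  move=> Fa; rewrite -[X in nseq X](size_enum_ord n) -(size_map F).
  by apply/all_pred1P/allP => _ /mapP[i _ ->] /=; rewrite Fa.
rewrite -cats1 !map_cat !map_nseq /= !enum_ordD !map_cat -!catA.
congr (_ ++ (_ ++ _)).
- rewrite -2!map_comp; apply: map_const => i /=.
  by rewrite /hermite_mx !block_mxEul mxE eqxx.
- rewrite -2!map_comp; apply: map_const => i /=.
  by rewrite /hermite_mx block_mxEul block_mxEdr mxE eqxx expn1.
rewrite -map_comp; apply: (map_const 1%N) => i /=.
by rewrite /hermite_mx block_mxEdr mxE eqxx.
Qed.

Lemma hermite_mx_hnf :
  (1 < p)%N -> hermite_normal_form (hermite_mx p (ord_mx X)).
Proof.
move=> p_gt1; split.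
- rewrite !det_ublock !det_scalar expr1n mulr1.
  by rewrite mulr_gt0 // !exprn_gt0 //; lia.
- move=> i j; rewrite /hermite_mx.
  case: (split_ordP i) => {}i ->; case: (split_ordP j) => {}j -> /= ji.
  + rewrite block_mxEul.
    case: (split_ordP i) ji => {}i ->; case: (split_ordP j) => {}j -> /= ji.
    * by rewrite block_mxEul mxE -val_eqE /= gtn_eqF.
    * by have := ltn_ord i; lia.
    * by rewrite block_mxEdl mxE.
    * by rewrite block_mxEdr mxE -val_eqE /= gtn_eqF //; lia.
  + by have := ltn_ord i; lia.
  + by rewrite block_mxEdl mxE.
  + by rewrite !ord1 ltnn in ji.
move=> i j; rewrite /hermite_mx.
case: (split_ordP i) => {}i ->; case: (split_ordP j) => {}j -> /= ij.
- rewrite !block_mxEul.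
  case: (split_ordP i) ij => {}i ->; case: (split_ordP j) => {}j -> /= ij.
  + by rewrite !block_mxEul !mxE eqxx -val_eqE /= ltn_eqF //; lia.
  + rewrite block_mxEul block_mxEur !mxE eqxx.
    (* The entry is p x with 0 <= x <= p - 1, so it stays below p^2. *)
    by have := ltn_ord (X i j); nia.
  + by have := ltn_ord j; lia.
  + by rewrite !block_mxEdr !mxE eqxx -val_eqE /= ltn_eqF //; lia.
(* In the last column the entry 1 must be below p^2 or p, which holds as p > 1. *)
- rewrite block_mxEur block_mxEul mxE.
  case: (split_ordP i) ij => {}i -> _.
  + by rewrite block_mxEul mxE eqxx; nia.
  + by rewrite block_mxEdr mxE eqxx; lia.
- by have := ltn_ord j; lia.
- by rewrite !ord1 ltnn in ij.
Qed.
End HermiteForm.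

(** * Distinctness of the lattices, and the bound *)

Lemma hermite_mx_span_inj p r s : (0 < p)%N ->
  injective (fun X : 'M['I_p]_(r, s) => column_span (hermite_mx p (ord_mx X))).
Proof.
move=> p_gt0 X Y XY; apply/matrixP => i j.
(* This vector has top block p times column j of [X] and middle block p e_j. In the span of [Y] the
   middle block forces y = e_j, so the two columns j agree modulo p. *)
have : column_span (hermite_mx p (ord_mx Y))
    (span_vec p (ord_mx X) 0 (delta_mx j 0) 0).
  by rewrite -XY; apply/hermite_mx_spanP; do 3 eexists.
case/hermite_mx_spanP=> z [y [t]].
rewrite {1}span_vec0 scaler0 add0r => /span_vec_coord[eB ey _].
have scale_inj a b (u v : 'M[int]_(a, b)) : p%:Z *: u = p%:Z *: v -> u = v.
  move=> /matrixP uv; apply/matrixP => k l.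
  by move: (uv k l); rewrite !mxE => /mulfI; apply; lia.
move: (scale_inj _ _ _ _ eB); rewrite -(scale_inj _ _ _ _ ey) -!colE.
by move/colP/(_ i); rewrite !mxE; exact: ord_eq_mod.
Qed.

Local Close Scope ring_scope.
Local Close Scope classical_set_scope.

Theorem proposition4p1 (p n r s m : nat) (alpha : seq nat)
    (hp : prime p)
    (hcomp : is_composition m alpha)
    (hsize : size alpha = n.-1)
    (halpha : alpha = nseq r 2 ++ nseq s 1) :
  (p ^ (r * s) <= g n alpha p)%N.
Proof.
have p_gt0 := prime_gt0 hp.
have n_eq : n = (r + s + 1)%N.
  (* Since [n.-1] is 0 for n = 0 too, nonemptiness of [alpha] is what excludes n = 0. *)
  have : (0 < size alpha)%N.
    by case: hcomp => m_gt0 _; case: (alpha) => // m0; rewrite -m0 in m_gt0.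
  by move: hsize; rewrite halpha size_cat !size_nseq; lia.
rewrite halpha n_eq /g.
have <- : #|{: 'M['I_p]_(r, s)}| = (p ^ (r * s))%N by rewrite card_mx card_ord.
rewrite -(card_fset_set_range (@hermite_mx_span_inj p r s p_gt0)).
apply/fsubset_leq_card; set S := [set L | _]%classic.
have S_fin : finite_set S.
  by apply: sub_finite_set (@finite_has_diagonal _ _) => L [_]; exact.
rewrite -fset_set_sub //; last exact/finite_image/finite_finset.
move=> _ [X _ <-]; split; first exact: hermite_mx_span_irreducible.
exists (hermite_mx p (ord_mx X)); split => //; last exact: hermite_mx_diagonal.
by apply: hermite_mx_hnf; exact: prime_gt1.
Qed.
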